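(* For any permutation $\pi\in S_n$ and any Jacobi matrix $J$ with spectrum $\{\lambda_1,\ldots,\lambda_n\}$, the norming constants $w_i$ and the $\pi$-bidiagonal coordinates $\beta^\pi_i$ of $J$ are related by $$w_{\pi(i)} = w_{\pi(1)}\left|\frac{\beta^\pi_1\cdots\beta^\pi_{i-1}}{(\lambda^\pi_i-\lambda^\pi_1)\cdots(\lambda^\pi_i-\lambda^\pi_{i-1})}\right|,\quad 2\le i\le n,$$ $$\beta^\pi_i = \left|\frac{(\lambda_{\pi(i+1)}-\lambda_{\pi(1)})\cdots(\lambda_{\pi(i+1)}-\lambda_{\pi(i)})}{(\lambda_{\pi(i)}-\lambda_{\pi(1)})\cdots(\lambda_{\pi(i)}-\lambda_{\pi(i-1)})}\right|\frac{w_{\pi(i+1)}}{w_{\pi(i)}},\quad 1\le i\le n-1.$$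
   Context: Fix real numbers $\lambda_1 < \cdots < \lambda_n$ and $\Lambda = \operatorname{diag}(\lambda_1,\ldots,\lambda_n)$. A Jacobi matrix is a real symmetric tridiagonal $n \times n$ matrix $J$ with $(J)_{i+1,i}>0$ for $i=1,\ldots,n-1$. $Q^*$ denotes the transpose and $O(n)$ the real orthogonal group. Empty products equal $1$. A square matrix $M$ is $LU$-positive if it admits a (unique) factorization $M = LU$ with $L = \mathbf{L}(M)$ lower triangular with unit diagonal and $U$ upper triangular with positive diagonal entries. For $\pi \in S_n$, let $\lambda^\pi_i = \lambda_{\pi(i)}$ and $\Lambda^\pi = \operatorname{diag}(\lambda^\pi_1,\ldots,\lambda^\pi_n)$. Every Jacobi matrix $J$ with spectrum $\{\lambda_1,\ldots,\lambda_n\}$ has, for each $\pi$, a unique $\pi$-normalized diagonalization $J = Q_\pi^*\Lambda^\pi Q_\pi$ with $Q_\pi \in O(n)$ an $LU$-positive matrix. Norming constants of $J$: $w_{\pi(i)} = |(Q_\pi)_{i,1}|$ for $i=1,\ldots,n$; i.e. $w_j>0$ is the absolute value of the first coordinate of a normalized eigenvector of $J$ associated with $\lambda_j$ (this does not depend on $\pi$). $\pi$-bidiagonal coordinates of $J$: let $L_\pi = \mathbf{L}(Q_\pi)$ and $B_\pi = L_\pi^{-1}\Lambda^\pi L_\pi$; this matrix is lower bidiagonal, and $\beta^\pi_i = (B_\pi)_{i+1,i}$ for $i=1,\ldots,n-1$. *)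

(* Defs.v *)
From mathcomp Require Import all_boot all_order all_fingroup all_algebra.
From mathcomp Require Import boolp classical_sets reals.

Set Implicit Arguments.
Unset Strict Implicit.
Unset Printing Implicit Defensive.

Import Order.TTheory GRing.Theory Num.Theory.
Local Open Scope ring_scope.
Local Open Scope classical_set_scope.

(* Matrices have size n.+1 and all indices are 0-based: the usual 1-based index i
   is the ordinal of value i.-1. *)

Definition jacobi (R : realType) (n : nat) (J : 'M[R]_n.+1) : Prop :=
  [/\ J^T = J,
      forall i j : 'I_n.+1, (i.+1 < j)%N || (j.+1 < i)%N -> J i j = 0
    & forall i j : 'I_n.+1, j = i.+1 :> nat -> 0 < J j i].

(* In MathComp is_trig_mx means lower triangular. *)
Definition LU_factorization (R : realType) (n : nat) (M L U : 'M[R]_n) : Prop :=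
  [/\ M = L *m U,
      is_trig_mx L /\ (forall i, L i i = 1)
    & is_trig_mx U^T /\ (forall i, 0 < U i i)].

Definition LU_positive (R : realType) (n : nat) (M : 'M[R]_n) : Prop :=
  exists L U : 'M[R]_n, LU_factorization M L U.

(* xget x0 A is an element of A if A is nonempty and x0 otherwise. Below it is
   only used to name objects that exist and are unique in the intended
   situation, so that the default values are never reached there. *)
Definition Lpart (R : realType) (n : nat) (M : 'M[R]_n) : 'M[R]_n :=
  xget 1%:M [set L | exists U, LU_factorization M L U].

Definition permuted_diag (R : realType) (n : nat) (lam : 'I_n -> R)
    (pi : 'S_n) : 'M[R]_n :=
  diag_mx (\row_i lam (pi i)).

Definition normalized_diagonalization (R : realType) (n : nat)
    (lam : 'I_n -> R) (pi : 'S_n) (J Q : 'M[R]_n) : Prop :=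
  [/\ J = Q^T *m permuted_diag lam pi *m Q, Q^T *m Q = 1%:M & LU_positive Q].

Definition normalized_Q (R : realType) (n : nat) (lam : 'I_n -> R) (pi : 'S_n)
    (J : 'M[R]_n) : 'M[R]_n :=
  xget 0 [set Q | normalized_diagonalization lam pi J Q].

(* w_j is the common value of |(Q_pi)_{i,1}| over all pi and i with
   pi i = j. *)
Definition norming_constant (R : realType) (n : nat) (lam : 'I_n.+1 -> R)
    (J : 'M[R]_n.+1) (j : 'I_n.+1) : R :=
  xget 0 [set x : R | forall (pi : 'S_n.+1) (i : 'I_n.+1),
            pi i = j -> x = `|normalized_Q lam pi J i ord0|].

Definition bidiagonal_matrix (R : realType) (n : nat) (lam : 'I_n -> R)
    (pi : 'S_n) (J : 'M[R]_n) : 'M[R]_n :=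
  let L := Lpart (normalized_Q lam pi J) in
  invmx L *m permuted_diag lam pi *m L.

(* For i : 'I_n, the ordinals of 'I_n.+1 with values i and i.+1. *)
Definition ord_cur (n : nat) (i : 'I_n) : 'I_n.+1 := widen_ord (leqnSn n) i.
Definition ord_next (n : nat) (i : 'I_n) : 'I_n.+1 := lift ord0 i.

Definition bidiagonal_coordinate (R : realType) (n : nat)
    (lam : 'I_n.+1 -> R) (pi : 'S_n.+1) (J : 'M[R]_n.+1) (i : 'I_n) : R :=
  bidiagonal_matrix lam pi J (ord_next i) (ord_cur i).

(* Main.v *)
Require Import Defs.
From mathcomp Require Import all_boot all_order all_fingroup all_algebra.
From mathcomp Require Import boolp classical_sets reals.

Set Implicit Arguments.
Unset Strict Implicit.
Unset Printing Implicit Defensive.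

Import Order.TTheory GRing.Theory Num.Theory.
Local Open Scope ring_scope.

(** Write [mu i = lam (pi i)] and [N_k(x) = (x - mu_0) ... (x - mu_(k-1))]
    for the Newton polynomials of the reordered spectrum, and let
    [Q J = diag(mu) Q]. Applying [N_k(J)] to the first basis vector [e_0] gives
    the columns of a matrix [K]; since [J] is a Jacobi matrix, [K] is upper
    triangular with positive diagonal ([newton_mx_trig], [newton_mx_diag_gt0]).
    On the other side, [Q] diagonalizes [J], so the entries of [Q K] are
    [N_k(mu_i) Q_i0] ([mulmx_newton]). This matrix is lower triangular because
    [N_k] vanishes at [mu_0, ..., mu_(k-1)].

    Hence [Q] times an upper triangular matrix is an explicit lower triangular
    matrix, which determines the LU factorization of [Q] ([LU_newton]): if
    [Q = L U] then column [k] of [L], scaled by some [d_k > 0], has the entries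
    [N_k(mu_i) Q_i0]. The diagonal entries give [d_k = N_k(mu_k) Q_k0], hence
    [d_k = |N_k(mu_k)| w_(pi k)]. The recurrence
    [x N_k(x) = N_(k+1)(x) + mu_k N_k(x)] says that [diag(mu) L = L B] with [B]
    lower bidiagonal and subdiagonal entries [beta_k = d_(k+1) / d_k]
    ([bidiagonal_entry]). This is the second formula, and the first one is the
    telescoping product [beta_0 ... beta_(i-1) = d_i / d_0].

    The objects involved have to exist. The rows of an orthogonal [Q] are
    normalized eigenvectors; the same matrix identity shows that their first
    coordinates are nonzero ([first_column_neq0]) and that [Q] is LU-positive
    exactly when all [N_i(mu_i) Q_i0] are positive. By the sufficiency of
    this condition ([LU_positive_newton]), a suitable choice of the signs of the
    rows makes [Q] normalized ([normalized_diagonalization_exists]). Finally,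
    normalized eigenvectors for simple eigenvalues are unique up to sign
    ([normalized_first_column]), so the norming constants are well defined. *)

(** * Triangular matrices *)

Section Triangular.

Variable F : fieldType.

Lemma trig_mulmx (n : nat) (A B : 'M[F]_n) :
  is_trig_mx A -> is_trig_mx B ->
  is_trig_mx (A *m B) /\ forall i, (A *m B) i i = A i i * B i i.
Proof.
move=> /is_trig_mxP trA /is_trig_mxP trB; split=> [|i].
  apply/is_trig_mxP => i j lt_ij; rewrite mxE big1 // => m _.
  have [lt_im|le_mi] := ltnP i m; first by rewrite trA ?mul0r.
  by rewrite [B m j]trB ?mulr0 // (leq_ltn_trans le_mi).
rewrite mxE (bigD1 i) //= big1 ?addr0 // => m ne_mi.
have [lt_im|lt_mi|/val_inj eq_im] := ltngtP i m.
- by rewrite trA ?mul0r.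
- by rewrite trB ?mulr0.
- by rewrite eq_im eqxx in ne_mi.
Qed.

(** Forward substitution, column by column. *)
Lemma trig_solve (n : nat) (A X : 'M[F]_n) :
  is_trig_mx A -> (forall i, A i i != 0) -> is_trig_mx (A *m X) ->
  is_trig_mx X.
Proof.
move=> /is_trig_mxP trA nzA /is_trig_mxP trAX.
apply/is_trig_mxP => i j; have [m] := ubnP (nat_of_ord i).
elim: m i => // m IHm i lt_im lt_ij; have := trAX i j lt_ij.
rewrite mxE (bigD1 i) //= big1 ?addr0.
  by move/eqP; rewrite mulf_eq0 (negbTE (nzA i)) => /eqP.
move=> k ne_ki; have [lt_ik|lt_ki|/val_inj eq_ik] := ltngtP i k.
- by rewrite trA ?mul0r.
- by rewrite IHm ?mulr0 ?(ltn_trans lt_ki lt_ij) // (leq_trans lt_ki).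
- by rewrite eq_ik eqxx in ne_ki.
Qed.

Lemma trig_unitmx (n : nat) (A : 'M[F]_n) :
  is_trig_mx A -> (forall i, A i i != 0) -> A \in unitmx.
Proof.
move=> trA nzA; rewrite unitmxE det_trig // unitfE.
by apply/prodf_neq0 => i _; apply: nzA.
Qed.

End Triangular.

(** * Newton polynomials *)

Lemma prod_ord_ltS (R : comPzSemiRingType) (n : nat) (F : 'I_n -> R)
    (k : 'I_n) :
  \prod_(j < n | (j < k.+1)%N) F j = F k * \prod_(j < n | (j < k)%N) F j.
Proof.
rewrite (bigD1 k) //=; congr (_ * _); apply: eq_bigl => j.
by rewrite ltnS ltn_neqAle andbC.
Qed.

Section Newton.

Variables (R : realType) (n : nat) (mu : 'I_n.+1 -> R).

Definition newton (k : nat) (x : R) : R :=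
  \prod_(j < n.+1 | (j < k)%N) (x - mu j).

Lemma newton0 x : newton 0 x = 1.
Proof. by rewrite /newton big_pred0. Qed.

Lemma newtonS (k : 'I_n.+1) x : newton k.+1 x = (x - mu k) * newton k x.
Proof. exact: prod_ord_ltS. Qed.

Lemma newton_eq0 (i : 'I_n.+1) k : (i < k)%N -> newton k (mu i) = 0.
Proof. by move=> lt_ik; rewrite /newton (bigD1 i) //= subrr mul0r. Qed.

Lemma newton_neq0 (i : 'I_n.+1) : injective mu -> newton i (mu i) != 0.
Proof.
move=> inj_mu; apply/prodf_neq0 => j lt_ji.
by rewrite subr_eq0 (inj_eq inj_mu) neq_ltn lt_ji orbT.
Qed.

(** [newton_vec J k] is [N_k(J)] applied to the first basis vector. *)
Fixpoint newton_vec (J : 'M[R]_n.+1) (k : nat) : 'cV[R]_n.+1 :=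
  if k is k'.+1 then (J - (mu (inord k'))%:M) *m newton_vec J k'
  else delta_mx ord0 ord0.

Definition newton_mx (J : 'M[R]_n.+1) : 'M[R]_n.+1 :=
  \matrix_(i, k) newton_vec J k i ord0.

(** The matrix [Q K] of the eigenvector coordinates; it depends on the first
    column of [Q] only. *)
Definition newton_values (q : 'cV[R]_n.+1) : 'M[R]_n.+1 :=
  \matrix_(i, k) (newton k (mu i) * q i ord0).

Lemma newton_values_trig q : is_trig_mx (newton_values q).
Proof. by apply/is_trig_mxP => i k lt_ik; rewrite mxE newton_eq0 ?mul0r. Qed.

(** A tridiagonal matrix pushes the support of a vector down by one at most. *)
Lemma newton_vec_eq0 J k (i : 'I_n.+1) :
  jacobi J -> (k < i)%N -> newton_vec J k i ord0 = 0.
Proof.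
move=> [_ tridiag _]; elim: k i => [|k IHk] i lt_ki.
  by rewrite mxE -val_eqE /= gtn_eqF.
rewrite /= mulmxBl mul_scalar_mx !mxE (IHk i) ?(ltnW lt_ki) // mulr0 subr0.
rewrite big1 // => m _; have [lt_km|le_mk] := ltnP k m.
  by rewrite IHk ?mulr0.
by rewrite tridiag ?mul0r // (leq_ltn_trans _ lt_ki) ?orbT.
Qed.

Lemma newton_vec_gt0 J (k : 'I_n.+1) :
  jacobi J -> 0 < newton_vec J k k ord0.
Proof.
move=> jacJ; have [_ tridiag subdiag] := jacJ.
case: k => k lt_kn /=; elim: k lt_kn => [|k IHk] lt_kn.
  by rewrite /= mxE -val_eqE /= ltr01.
have lt_k := ltnW lt_kn; have := IHk lt_k; set v := newton_vec J k => v_gt0.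
rewrite /= mulmxBl mul_scalar_mx !mxE newton_vec_eq0 //= mulr0 subr0.
(* Only the subdiagonal entry of the row meets the support of [v]. *)
rewrite (bigD1 (Ordinal lt_k)) //= big1 ?addr0.
  by apply: mulr_gt0 => //; apply: subdiag.
move=> m ne_mk; have [lt_km|lt_mk|eq_mk] := ltngtP k m.
- by rewrite newton_vec_eq0 ?mulr0.
- by rewrite tridiag ?mul0r //= ltnS lt_mk orbT.
- by rewrite -val_eqE /= eq_mk eqxx in ne_mk.
Qed.

Lemma newton_mx_trig J : jacobi J -> is_trig_mx (newton_mx J)^T.
Proof.
by move=> jacJ; apply/is_trig_mxP => i j lt_ij; rewrite !mxE newton_vec_eq0.
Qed.

Lemma newton_mx_diag_gt0 J i : jacobi J -> 0 < newton_mx J i i.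
Proof. by move=> jacJ; rewrite mxE newton_vec_gt0. Qed.

Lemma newton_mx_unit J : jacobi J -> newton_mx J \in unitmx.
Proof.
move=> jacJ; rewrite -unitmx_tr trig_unitmx ?newton_mx_trig // => i.
by rewrite mxE gt_eqF ?newton_mx_diag_gt0.
Qed.

(** Since [Q p(J) = p(diag(mu)) Q] for every polynomial [p]. *)
Lemma mulmx_newton J Q :
  Q *m J = diag_mx (\row_i mu i) *m Q ->
  Q *m newton_mx J = newton_values (col ord0 Q).
Proof.
move=> QJ; suff vecE k : (k <= n)%N -> forall i,
    (Q *m newton_vec J k) i ord0 = newton k (mu i) * Q i ord0.
  apply/matrixP => i k; have le_kn : (k <= n)%N by rewrite -ltnS.
  rewrite [RHS]mxE [col _ _ _ _]mxE -vecE // !mxE.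
  by apply: eq_bigr => m _; rewrite [newton_mx _ _ _]mxE.
elim: k => [|k IHk] le_kn i.
  by rewrite /= -colE mxE newton0 mul1r.
rewrite /= mulmxA mulmxBr QJ mulmxBl mul_mx_scalar -mulmxA -scalemxAl.
move: (Q *m _) (IHk (ltnW le_kn) i) => y yE; rewrite mul_diag_mx !mxE yE.
have := newtonS (inord k) (mu i); rewrite (inordK (leqW le_kn)) => ->.
by rewrite -mulrBl mulrA.
Qed.

End Newton.

(** * The LU factorization of a matrix of eigenvectors *)

Section Eigenvectors.

Variables (R : realType) (n : nat) (mu : 'I_n.+1 -> R) (J Q : 'M[R]_n.+1).
Hypotheses (jacJ : jacobi J) (QJ : Q *m J = diag_mx (\row_i mu i) *m Q).

(** Otherwise [Q K], a product of invertible matrices, would have a zero row. *)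
Lemma first_column_neq0 i : Q \in unitmx -> Q i ord0 != 0.
Proof.
move=> unitQ; apply: contraTneq isT => qi0.
have: newton_values mu (col ord0 Q) \in unitmx.
  by rewrite -(mulmx_newton QJ) unitmx_mul unitQ newton_mx_unit.
move=> /mulmxV /(congr1 (fun M : 'M_n.+1 => M i i)).
rewrite !mxE eqxx big1 => [/eqP|k _]; first by rewrite eq_sym oner_eq0.
by rewrite !mxE qi0 mulr0 mul0r.
Qed.

(** [L (U K) = Q K] with [L] and [Q K] lower triangular forces [U K] to be lower
    triangular as well; it is also upper triangular, hence diagonal. *)
Lemma LU_newton L U :
  LU_factorization Q L U ->
  exists2 d : 'I_n.+1 -> R, forall k, 0 < d k &
    forall i k, L i k * d k = newton mu k (mu i) * Q i ord0.
Proof.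
move=> [QLU [trL L1] [trU U_gt0]]; set K := newton_mx mu J.
have LUK : L *m (U *m K) = newton_values mu (col ord0 Q).
  by rewrite mulmxA -QLU mulmx_newton.
have lowerUK : is_trig_mx (U *m K).
  apply: (trig_solve trL) => [i|]; first by rewrite L1 oner_eq0.
  by rewrite LUK newton_values_trig.
have trK : is_trig_mx K^T by apply: newton_mx_trig.
have [upperUK diagUK] := trig_mulmx trK trU.
exists (fun k => (U *m K) k k) => [k|i k].
  have := diagUK k; rewrite -trmx_mul mxE => ->; rewrite !mxE.
  by rewrite mulr_gt0 // newton_vec_gt0.
have := congr1 (fun M : 'M_n.+1 => M i k) LUK.
rewrite /= [RHS]mxE [col _ _ _ _]mxE => <-.
rewrite [RHS]mxE (bigD1 k) //= big1 ?addr0 // => m ne_mk.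
suff -> : (U *m K) m k = 0 by rewrite mulr0.
have [lt_mk|lt_km|/val_inj eq_mk] := ltngtP m k.
- exact: (is_trig_mxP lowerUK).
- by have := is_trig_mxP upperUK _ _ lt_km; rewrite -trmx_mul mxE.
- by rewrite eq_mk eqxx in ne_mk.
Qed.

(** Conversely, [L = Q K D^-1] and [U = L^-1 Q] are the LU factors, where [D] is
    the diagonal part of [Q K]; here [U] is upper triangular because
    [U K = D]. *)
Lemma LU_positive_newton :
  (forall i : 'I_n.+1, 0 < newton mu i (mu i) * Q i ord0) -> LU_positive Q.
Proof.
pose d (i : 'I_n.+1) := newton mu i (mu i) * Q i ord0.
move=> d_gt0; have nzd i : d i != 0 by rewrite gt_eqF ?d_gt0.
set K := newton_mx mu J.
set G := newton_values mu (col ord0 Q).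
have QK : Q *m K = G by apply: mulmx_newton.
pose L := \matrix_(i, k) (G i k / d k).
have trL : is_trig_mx L.
  apply/is_trig_mxP => i k lt_ik.
  by rewrite mxE (is_trig_mxP (newton_values_trig _ _)) ?mul0r.
have L1 i : L i i = 1 by rewrite !mxE divff // nzd.
have unitL : L \in unitmx by rewrite trig_unitmx // => i; rewrite L1 oner_eq0.
have LD : L *m diag_mx (\row_k d k) = G.
  by apply/matrixP => i k; rewrite mul_mx_diag !mxE divfK // nzd.
pose U := invmx L *m Q.
have UK : U *m K = diag_mx (\row_k d k) by rewrite -mulmxA QK -LD mulKmx.
have KU : K^T *m U^T = diag_mx (\row_k d k) by rewrite -trmx_mul UK tr_diag_mx.
have trK : is_trig_mx K^T by apply: newton_mx_trig.
have trU : is_trig_mx U^T.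
  apply: (trig_solve trK) => [i|]; last by rewrite KU diag_mx_is_trig.
  by rewrite mxE gt_eqF ?newton_mx_diag_gt0.
exists L, U; split=> //; first by rewrite mulKVmx.
split=> // i; have [_ /(_ i)] := trig_mulmx trK trU.
rewrite KU !mxE eqxx mulr1n => Ei.
by have := d_gt0 i; rewrite -/(d i) Ei pmulr_rgt0 // newton_vec_gt0.
Qed.

(** The recurrence [x N_k(x) = N_(k+1)(x) + mu_k N_k(x)] expresses column [k]
    of [diag(mu) L] in the columns [k] and [k+1] of [L]. *)
Lemma bidiagonal_entry L (d : 'I_n.+1 -> R) (i : 'I_n) :
  L \in unitmx -> (forall k, 0 < d k) ->
  (forall j k, L j k * d k = newton mu k (mu j) * Q j ord0) ->
  (invmx L *m diag_mx (\row_j mu j) *m L) (ord_next i) (ord_cur i) =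
    d (ord_next i) / d (ord_cur i).
Proof.
move=> unitL d_gt0 Ld; set c := ord_cur i; set s := ord_next i.
have nzc : d c != 0 by rewrite gt_eqF.
have eqLB : diag_mx (\row_j mu j) *m col c L =
    L *m (mu c *: delta_mx c ord0 + (d s / d c) *: delta_mx s ord0 : 'cV_n.+1).
  rewrite mulmxDr -!scalemxAr -!colE; apply/matrixP => j k.
  rewrite mul_diag_mx !mxE; apply: (mulIf nzc).
  rewrite mulrDl -!mulrA (mulrCA (d c)^-1) mulVf // mulr1.
  rewrite [d s * _]mulrC !Ld [newton mu s _](newtonS mu c) !mulrA.
  by rewrite -!mulrDl addrC subrK.
have := congr1 (fun v => (invmx L *m v) s ord0) eqLB.
rewrite mulKmx // [col c L]colE !mulmxA -colE [LHS]mxE => ->.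
rewrite !mxE !eqxx /= mulr1 -val_eqE /= /bump /= add1n.
by rewrite gtn_eqF // mulr0 add0r.
Qed.

End Eigenvectors.

(** * Normalized diagonalizations and norming constants *)

Section Normalized.

Variables (R : realType) (n : nat) (lam : 'I_n.+1 -> R) (J : 'M[R]_n.+1).
Hypotheses (inj_lam : injective lam) (jacJ : jacobi J).
Hypothesis eigJ : forall i, eigenvalue J (lam i).

Lemma normalized_intertwine pi Q :
  normalized_diagonalization lam pi J Q ->
  Q *m J = diag_mx (\row_i lam (pi i)) *m Q.
Proof.
move=> [-> /mulmx1C orthQ _].
by rewrite !mulmxA orthQ mul1mx.
Qed.

(** Normalized eigenvectors form an orthogonal matrix because the eigenvalues
    are distinct. The signs of the rows are then free, and are chosen to make the
    numbers [N_i(mu_i) Q_i0] positive. *)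
Lemma normalized_diagonalization_exists pi :
  exists Q, normalized_diagonalization lam pi J Q.
Proof.
pose mu i := lam (pi i).
have inj_mu : injective mu by move=> i j /inj_lam /perm_inj.
have /choice[v vP] (i : 'I_n.+1) :
    exists u : 'rV[R]_n.+1, u *m J = mu i *: u /\ u != 0.
  by have /eigenvalueP[u] := eigJ (pi i); exists u.
have symJ : J^T = J by case: jacJ.
pose dot (x y : 'rV[R]_n.+1) : R := (x *m y^T) ord0 ord0.
have dot_ortho i j : i != j -> dot (v i) (v j) = 0.
  move=> ne_ij; have: mu i * dot (v i) (v j) = mu j * dot (v i) (v j).
    have: v i *m J *m (v j)^T = v i *m (v j *m J)^T.
      by rewrite trmx_mul symJ mulmxA.
    rewrite (vP i).1 (vP j).1 linearZ /= -scalemxAl -scalemxAr.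
    move/matrixP => /(_ ord0 ord0).
    by rewrite [X in X = _ -> _]mxE [X in _ = X -> _]mxE.
  move/eqP; rewrite -subr_eq0 -mulrBl mulf_eq0 subr_eq0 (inj_eq inj_mu).
  by rewrite (negbTE ne_ij) => /eqP.
have dotE x y : dot x y = \sum_k x ord0 k * y ord0 k.
  by rewrite /dot mxE; apply: eq_bigr => k _; rewrite mxE.
have dot_gt0 i : 0 < dot (v i) (v i).
  have dot_ge0 k : 0 <= v i ord0 k * v i ord0 k by rewrite -expr2 sqr_ge0.
  rewrite dotE lt0r sumr_ge0 // andbT; apply: contraNneq (vP i).2 => /eqP.
  rewrite psumr_eq0 // => /allP v0; apply/eqP/rowP => k; rewrite mxE.
  by have := v0 k (mem_index_enum k); rewrite mulf_eq0 orbb => /eqP.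
pose Qs (s : 'I_n.+1 -> R) : 'M[R]_n.+1 :=
  \matrix_(i, k) (s i / Num.sqrt (dot (v i) (v i)) * v i ord0 k).
have QsJ s : Qs s *m J = diag_mx (\row_i mu i) *m Qs s.
  apply/matrixP => i k; rewrite mul_diag_mx !mxE mulrCA.
  have /matrixP/(_ ord0 k) := (vP i).1; rewrite !mxE => <-.
  by rewrite mulr_sumr; apply: eq_bigr => m _; rewrite mxE mulrA.
have Qs_ortho s : (forall i, s i ^+ 2 = 1) -> Qs s *m (Qs s)^T = 1%:M.
  move=> s2; apply/matrixP => i j; rewrite !mxE.
  transitivity (s i / Num.sqrt (dot (v i) (v i)) *
    (s j / Num.sqrt (dot (v j) (v j))) * dot (v i) (v j)).
    rewrite [dot (v i) (v j)]dotE mulr_sumr; apply: eq_bigr => m _.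
    by rewrite !mxE mulrACA.
  have [<-|ne_ij] := eqVneq i j; last by rewrite (dot_ortho _ _ ne_ij) mulr0.
  rewrite -expr2 exprMn s2 mul1r exprVn sqr_sqrtr ?(ltW (dot_gt0 i)) //.
  by rewrite mulVf // gt_eqF.
have Qs_neq0 s (i : 'I_n.+1) : (forall j, s j ^+ 2 = 1) ->
    newton mu i (mu i) * Qs s i ord0 != 0.
  move=> s2; rewrite mulf_neq0 ?newton_neq0 //.
  rewrite (first_column_neq0 jacJ (QsJ s)) //.
  by have [] := mulmx1_unit (Qs_ortho s s2).
pose s (i : 'I_n.+1) := Num.sg (newton mu i (mu i) * Qs (fun=> 1) i ord0).
have s2 i : s i ^+ 2 = 1 by rewrite sqr_sg Qs_neq0 // => j; rewrite expr1n.
exists (Qs s); have QTQ := mulmx1C (Qs_ortho s s2); split=> //.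
  by rewrite -mulmxA -[permuted_diag _ _ *m _]QsJ mulmxA QTQ mul1mx.
apply: (LU_positive_newton jacJ (QsJ s)) => i.
have -> : Qs s i ord0 = s i * Qs (fun=> 1) i ord0 by rewrite !mxE mul1r mulrA.
by rewrite mulrCA -normrEsg normr_gt0 Qs_neq0 // => j; rewrite expr1n.
Qed.

(** Row [i'] of [Q' Q^T] vanishes outside column [i], as rows for different
    eigenvalues are orthogonal; being a row of an orthogonal matrix, its entry
    there is 1 or -1. *)
Lemma normalized_first_column pi pi' Q Q' i i' :
  normalized_diagonalization lam pi J Q ->
  normalized_diagonalization lam pi' J Q' ->
  pi i = pi' i' -> `|Q i ord0| = `|Q' i' ord0|.
Proof.
move=> nQ nQ' eq_ii'; have Q'J := normalized_intertwine nQ'.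
have [defJ QTQ _] := nQ; have [_ QTQ' _] := nQ'.
have QQT := mulmx1C QTQ; have QQT' := mulmx1C QTQ'.
pose C := Q' *m Q^T.
have CQ : C *m Q = Q' by rewrite -mulmxA QTQ mulmx1.
have CCT : C *m C^T = 1%:M.
  by rewrite trmx_mul trmxK mulmxA CQ QQT'.
have Cdiag :
    C *m diag_mx (\row_i lam (pi i)) = diag_mx (\row_i lam (pi' i)) *m C.
  by rewrite /C mulmxA -Q'J -!mulmxA {1}defJ !mulmxA -!mulmxA QQT mulmx1.
clearbody C; have C0 m : m != i -> C i' m = 0.
  move=> ne_mi; have := congr1 (fun M : 'M_n.+1 => M i' m) Cdiag.
  rewrite /= mul_mx_diag mul_diag_mx !mxE mulrC -eq_ii' => /eqP.
  rewrite -subr_eq0 -mulrBl mulf_eq0 subr_eq0 (inj_eq inj_lam).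
  by rewrite (inj_eq perm_inj) (negbTE ne_mi) => /eqP.
have Ci : `|C i' i| = 1.
  have := congr1 (fun M : 'M_n.+1 => M i' i') CCT.
  rewrite /= mxE (bigD1 i) //= big1 => [|m /C0->]; last by rewrite mul0r.
  rewrite !mxE eqxx addr0 -expr2 => /eqP.
  by rewrite sqrf_eq1 => /orP[] /eqP ->; rewrite ?normrN normr1.
rewrite -CQ [X in _ = `|X|]mxE (bigD1 i) //= big1 => [|m /C0->].
  by rewrite addr0 normrM Ci mul1r.
by rewrite mul0r.
Qed.

Lemma normalized_QP pi :
  normalized_diagonalization lam pi J (normalized_Q lam pi J).
Proof. by apply: xgetPex; apply: normalized_diagonalization_exists. Qed.

Lemma norming_constantE (pi : 'S_n.+1) i :
  norming_constant lam J (pi i) = `|normalized_Q lam pi J i ord0|.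
Proof.
rewrite /norming_constant; set A := (X in xget _ X).
suff /(xgetPex 0) : exists x, A x by apply.
exists `|normalized_Q lam pi J i ord0| => pi' i' eq_ii'.
apply: (normalized_first_column (normalized_QP pi) (normalized_QP pi')).
exact: esym.
Qed.

(** The column scalings [d_k] of [LU_newton] are positive, so the diagonal
    identity [d_k = N_k(mu_k) Q_k0], where the unit diagonal of [L] enters, may
    be read in absolute values; this is what brings in the norming constants. *)
Lemma bidiagonal_norming (pi : 'S_n.+1) :
  let w := norming_constant lam J in
  let mu i := lam (pi i) in
  let d (k : 'I_n.+1) := `|newton mu k (mu k)| * w (pi k) in
  (forall k, 0 < d k) /\
  forall i, bidiagonal_coordinate lam pi J i = d (ord_next i) / d (ord_cur i).
Proof.
move=> w mu d; set Q := normalized_Q lam pi J; have nQ := normalized_QP pi.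
have QJ := normalized_intertwine nQ; have [_ _ [L0 [U0 LU0]]] := nQ.
have [U LU] : exists U, LU_factorization Q (Lpart Q) U.
  by apply: (@xgetPex _ _ [set L | exists U, LU_factorization Q L U]%classic);
     exists L0, U0.
have [_ [trL L1] _] := LU.
have unitL : Lpart Q \in unitmx.
  by rewrite trig_unitmx // => i; rewrite L1 oner_eq0.
have [d' d'_gt0 Ld'] := LU_newton jacJ QJ LU.
have d'E k : d' k = d k.
  rewrite /d /w norming_constantE -normrM -[newton _ _ _ * _]Ld' L1 mul1r.
  by rewrite gtr0_norm.
split=> [k|i]; first by rewrite -d'E.
by rewrite -!d'E; apply: (bidiagonal_entry _ unitL d'_gt0 Ld').
Qed.

End Normalized.

(** * The two formulas *)

Lemma telescope_ord (R : realType) (n : nat) (beta : 'I_n -> R)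
    (d : 'I_n.+1 -> R) (i : 'I_n.+1) :
  (forall k, d k != 0) ->
  (forall k, beta k = d (ord_next k) / d (ord_cur k)) ->
  \prod_(k < n | (k < i)%N) beta k = d i / d ord0.
Proof.
move=> nzd betaE; case: i => i lt_in /=; elim: i lt_in => [|i IHi] lt_in.
  by rewrite big_pred0 // (_ : Ordinal _ = ord0) ?divff //; apply: val_inj.
rewrite (prod_ord_ltS beta (Ordinal (lt_in : i < n)%N)) /=.
rewrite (IHi (ltnW lt_in)) betaE.
rewrite (_ : ord_next _ = Ordinal lt_in); last exact: val_inj.
rewrite (_ : ord_cur _ = Ordinal (ltnW lt_in)); last exact: val_inj.
by rewrite mulrA divfK.
Qed.

Theorem proposition3p6 (R : realType) (n : nat) (lam : 'I_n.+1 -> R)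
    (lam_incr : forall i j : 'I_n.+1, (i < j)%N -> lam i < lam j)
    (pi : 'S_n.+1) (J : 'M[R]_n.+1) (J_jacobi : jacobi J)
    (J_spectrum : forall a : R, eigenvalue J a <-> exists i, a = lam i) :
  let w := norming_constant lam J in
  let beta := bidiagonal_coordinate lam pi J in
  (forall i : 'I_n.+1, (0 < i)%N ->
     w (pi i) = w (pi ord0) *
       `| (\prod_(k < n | (k < i)%N) beta k) /
          (\prod_(k < n.+1 | (k < i)%N) (lam (pi i) - lam (pi k))) |) /\
  (forall i : 'I_n,
     beta i =
       `| (\prod_(k < n.+1 | (k <= i)%N) (lam (pi (ord_next i)) - lam (pi k))) /
          (\prod_(k < n.+1 | (k < i)%N) (lam (pi (ord_cur i)) - lam (pi k))) |
       * (w (pi (ord_next i)) / w (pi (ord_cur i)))).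
Proof.
move=> w beta.
have inj_lam : injective lam.
  move=> i j eq_ij; apply: val_inj; case: (ltngtP i j) => // /lam_incr.
    by rewrite eq_ij ltxx.
  by rewrite eq_ij ltxx.
have eigJ i : eigenvalue J (lam i) by apply/J_spectrum; exists i.
pose mu i := lam (pi i).
pose d (k : 'I_n.+1) : R := `|newton mu k (mu k)| * w (pi k).
have [d_gt0 betaE] : (forall k, 0 < d k) /\
    forall i, beta i = d (ord_next i) / d (ord_cur i).
  exact: bidiagonal_norming.
have d0 : d ord0 = w (pi ord0) by rewrite /d newton0 normr1 mul1r.
have nz_newton (i : 'I_n.+1) : newton mu i (mu i) != 0.
  by apply: newton_neq0 => j k /inj_lam /perm_inj.
split=> i.
  move=> _; rewrite (@telescope_ord _ _ _ d) // => [|k]; last by rewrite gt_eqF.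
  rewrite -[\prod_(k < n.+1 | _) _]/(newton mu i (mu i)) normrM normfV.
  rewrite (gtr0_norm (divr_gt0 (d_gt0 i) (d_gt0 ord0))) -d0 mulrA mulrCA.
  by rewrite divff ?gt_eqF // mulr1 /d mulrC mulKf // normr_eq0.
by rewrite betaE /d normrM normfV -mulf_div.
Qed.
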